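(* Let $\alpha>0$, $n\in\mathbb N$, $0<a<b$ and let $x:[a,b]\to\mathbb R$ be a function of class $C^{n+1}$. Then, for $t\in(a,b]$, \[ {_a\mathcal{I}_t^\alpha} x(t)=\sum_{i=0}^{n}A_i(\alpha)\left(\ln\frac{t}{a}\right)^{\alpha+i} x_{i,0}(t)+\sum_{p=n+1}^\infty B(\alpha,p)\left(\ln\frac{t}{a}\right)^{\alpha+n-p}V_p(t), \] with \[ A_i(\alpha)=\frac{1}{\Gamma(\alpha+i+1)}\left[1+\sum_{p=n-i+1}^\infty\frac{\Gamma(p-\alpha-n)}{\Gamma(-\alpha-i)(p-n+i)!}\right],\qquad B(\alpha,p)=\frac{\Gamma(p-\alpha-n)}{\Gamma(\alpha)\Gamma(1-\alpha)(p-n)!}, \] \[ V_p(t)=\int_a^t (p-n)\left(\ln\frac{\tau}{a}\right)^{p-n-1}\frac{x(\tau)}{\tau}\,d\tau. \]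
   Context: For $0<a<b$ and $\alpha>0$ the left Hadamard fractional integral is ${_a\mathcal{I}_t^\alpha} x(t)=\frac{1}{\Gamma(\alpha)}\int_a^t \left(\ln\frac{t}{\tau}\right)^{\alpha-1}\frac{x(\tau)}{\tau}\,d\tau$. The functions $x_{k,0}$ are defined recursively by $x_{0,0}(t)=x(t)$ and $x_{k+1,0}(t)=t\frac{d}{dt}x_{k,0}(t)$ for $k\ge 0$. $\Gamma$ is Euler's gamma function.
   Formalization: The quotients Γ(p-α-n)/Γ(-α-i) and Γ(p-α-n)/Γ(1-α), undefined when α is a positive integer (poles of Γ), are read as the products (-α-i)_{p-n+i} and (1-α)_{p-n-1} of rising factors, which equal them for every non-integer α. *)

(* Defs.v *)
From HB Require Import structures.
From mathcomp Require Import all_boot all_order all_algebra.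
From mathcomp Require Import all_classical all_reals all_analysis.
Set Implicit Arguments. Unset Strict Implicit. Unset Printing Implicit Defensive.
Import Order.TTheory GRing.Theory Num.Theory.
Import numFieldNormedType.Exports.
Local Open Scope classical_set_scope.
Local Open Scope ring_scope.

Section Defs.
Variable R : realType.
Local Notation mu := (@lebesgue_measure R).

(* Euler's Gamma function (only used at positive arguments):
   Gamma s = int_0^oo u^(s-1) e^(-u) du. *)
Definition Gamma (s : R) : R :=
  Rintegral mu `]0, +oo[ (fun u => u `^ (s - 1) * expR (- u)).

(* Rising factorial (Pochhammer symbol) (c)_k = c (c+1) ... (c+k-1)
   = Gamma(c+k)/Gamma(c); used to give meaning to the quotients of Gamma
   values at possibly non-positive arguments. *)
Definition rising (c : R) (k : nat) : R := \prod_(j < k) (c + j%:R).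

Definition hadamard_int (alpha a : R) (x : R -> R) (t : R) : R :=
  (Gamma alpha)^-1 *
  Rintegral mu `[a, t] (fun tau => (ln (t / tau)) `^ (alpha - 1) * x tau / tau).

Definition deriv_within (a b : R) (f : R -> R) (t d : R) : Prop :=
  (fun s => (f s - f t) / (s - t)) @ within `[a, b] (t^') --> d.

Definition Ck_on (m : nat) (a b : R) (f : R -> R) : Prop :=
  exists D : nat -> R -> R,
    (forall t, a <= t <= b -> D 0%N t = f t) /\
    (forall k, (k < m)%N -> forall t, a <= t <= b ->
        deriv_within a b (D k) t (D k.+1 t)) /\
    (forall k, (k <= m)%N -> {within `[a, b], continuous (D k)}).

End Defs.

(* Main.v *)
(* Put s = ln (tau / a) / ln (t / a), which runs over [0, 1], and let c_k = (1 - alpha)_k / k!.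

   Every A_i vanishes: 1 plus its series is the full binomial series of (1 - z)^(alpha + i)
   at z = 1, whose partial sums telescope to (1 - alpha - i)_K / K!, which tends to 0.

   The second sum is the binomial series of (1 - s)^(alpha - 1) integrated term by term against
   x(tau) / tau.  The remainder R_K of that series after the term of index K is a nonnegative
   function times c_(K+1), hence of constant sign, so that its L^1 norm is the absolute value of
   its integral, which telescopes to c_(K+1) ln (t / a) / alpha.  As x is bounded and
   c_(K+1) -> 0, the integrals of R_K x tend to 0; no dominating function is needed. *)
Require Import Defs.
From HB Require Import structures.
From mathcomp Require Import all_boot all_order all_algebra.
From mathcomp Require Import ring lra.
From mathcomp Require Import all_classical all_reals all_analysis measurable_realfun.
Import Order.TTheory GRing.Theory Num.Theory.
Import numFieldNormedType.Exports.
Local Open Scope classical_set_scope.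
Local Open Scope ring_scope.

(** * Binomial coefficients at real exponents: recurrences, decay, and the sign of the series
    remainder *)

Section BinomialSeries.
Variable R : realType.
Implicit Types (c z u : R) (k K : nat).

(* The coefficient of [z ^+ k] in the binomial series of [(1 - z) `^ (- c)]. *)
Definition bcoef c k : R := rising c k / k`!%:R.

Definition bsum c K z : R := \sum_(k < K) bcoef c k * z ^+ k.

Lemma risingS c k : rising c k.+1 = rising c k * (c + k%:R).
Proof. by rewrite /rising big_ord_recr. Qed.

Lemma risingSl c k : rising c k.+1 = c * rising (c + 1) k.
Proof.
rewrite /rising big_ord_recl addr0; congr (_ * _).
by apply: eq_bigr => j _; rewrite -addrA -natr1 [1 + _]addrC.
Qed.

Lemma fact_neq0 k : k`!%:R != 0 :> R.
Proof. by rewrite pnatr_eq0 -lt0n fact_gt0. Qed.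

Lemma bcoef0 c : bcoef c 0 = 1.
Proof. by rewrite /bcoef /rising big_ord0 fact0 divr1. Qed.

Lemma bcoefS c k : bcoef c k.+1 = bcoef c k * ((c + k%:R) / k.+1%:R).
Proof.
rewrite /bcoef risingS factS natrM invfM; ring.
Qed.

(** The differential equation [(1 - z) y' = c y] of [y = (1 - z) ^ (- c)], read coefficientwise. *)
Lemma mul_bcoefS c k : k.+1%:R * bcoef c k.+1 = (c + k%:R) * bcoef c k.
Proof.
rewrite bcoefS; have : k.+1%:R != 0 :> R by rewrite pnatr_eq0.
by move=> ?; field.
Qed.

(** Coefficientwise form of the fact that [(1 - z) ^ (- c)] has derivative
    [c (1 - z) ^ (- (c + 1))]. *)
Lemma bcoef_shift c k : c * bcoef (c + 1) k = k.+1%:R * bcoef c k.+1.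
Proof.
rewrite /bcoef risingSl factS natrM.
by field; rewrite fact_neq0 nat1r pnatr_eq0.
Qed.

(** Dividing a power series by [1 - z] replaces its coefficients by their partial sums, and it turns
    [(1 - z) ^ (- c)] into [(1 - z) ^ (- (c + 1))]. *)
Lemma sum_bcoef c K : \sum_(k < K.+1) bcoef c k = bcoef (c + 1) K.
Proof.
elim: K => [|K IH]; first by rewrite big_ord1 !bcoef0.
rewrite big_ord_recr /= IH [RHS]bcoefS.
have k1 : K.+1%:R != 0 :> R by rewrite pnatr_eq0.
apply: (mulfI k1); rewrite mulrDr -bcoef_shift.
by rewrite -natr1 in k1 *; field.
Qed.

(** The ratio of consecutive coefficients is [1 - be / (k + 1)], at most [expR (- be / (k + 1))].
    Multiplying these bounds gives the exponential of [- be] times a harmonic sum, which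
    diverges. *)
Lemma bcoef_cvg0 (be : R) : 0 < be -> bcoef (1 - be) k @[k --> \oo] --> 0.
Proof.
move=> be0.
(* From this index on [be < k + 1], so the ratio is nonnegative and equals its absolute value. *)
pose N := Num.truncn be.
have step k : (N <= k)%N ->
    `|bcoef (1 - be) k.+1| <= `|bcoef (1 - be) k| * expR (- (be * harmonic k)).
  move=> Nk; rewrite bcoefS normrM ler_wpM2l//.
  have -> : (1 - be + k%:R) / k.+1%:R = 1 - be * harmonic k.
    have k1 : k.+1%:R != 0 :> R by rewrite pnatr_eq0.
    by rewrite /= -natr1 in k1 *; field.
  rewrite ger0_norm; last first.
    rewrite subr_ge0 /= ler_pdivrMr ?ltr0n// mul1r.
    by have /ltW/le_trans-> := truncnS_gt be; rewrite // ler_nat ltnS.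
  exact: expR_ge1Dx.
have bd k : `|bcoef (1 - be) (N + k)%N| <=
    `|bcoef (1 - be) N| * expR (- (be * (series harmonic (N + k)%N - series harmonic N))).
  elim: k => [|k IH]; first by rewrite addn0 subrr mulr0 oppr0 expR0 mulr1.
  rewrite addnS; apply: (le_trans (step _ _)); first exact: leq_addr.
  apply: (le_trans (ler_wpM2r (expR_ge0 _) IH)).
  rewrite -mulrA -expRD ler_wpM2l// ler_expR.
  rewrite seriesSr; lra.
have Hy : series (@harmonic R) n @[n --> \oo] --> +oo.
  apply: nondecreasing_dvgn_lt; last exact: dvg_harmonic.
  apply/nondecreasing_seqP => n; rewrite seriesSr lerDl; exact: harmonic_ge0.
rewrite -(cvg_shiftn N) /=.
apply: norm_cvg0.
apply: (squeeze_cvgr (f := cst 0) (h := fun k => `|bcoef (1 - be) N| *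
  expR (- (be * (series harmonic (N + k)%N - series harmonic N))))).
- by near=> k; rewrite normr_ge0 /= addnC bd.
- exact: cvg_cst.
rewrite -[X in _ --> X](mulr0 `|bcoef (1 - be) N|).
apply: cvgMl_tmp.
have : be * (series harmonic (N + k)%N - series harmonic N) @[k --> \oo] --> +oo%R.
  apply/cvgryPge => A; near=> k.
  rewrite mulrC -ler_pdivrMr// lerBrDr addnC; near: k.
  have := Hy; rewrite -(cvg_shiftn N) => /cvgryPge; exact.
by move=> H; exact: (cvg_comp _ (fun x => expR (- x)) H (@cvgr_expR R)).
Unshelve. all: by end_near. Qed.

(** The full series solves [(1 - u) y' = c y]; truncating it leaves a defect in the top degree
    only. *)
Lemma is_derive_bsum c K u : u < 1 ->
  is_derive u 1 (bsum c K.+1)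
    ((c * bsum c K.+1 u - K.+1%:R * bcoef c K.+1 * u ^+ K) / (1 - u)).
Proof.
move=> u1; have u1' : 1 - u != 0 by lra.
elim: K => [|K IH].
  have -> : bsum c 1 = cst 1.
    by apply/funext => x; rewrite /bsum big_ord1 bcoef0 expr0 mulr1.
  have -> : (c * cst 1 u - 1%:R * bcoef c 1 * u ^+ 0) / (1 - u) = 0.
    by rewrite mul_bcoefS addr0 bcoef0 expr0 !mulr1 subrr mul0r.
  exact: is_derive_cst.
have -> : bsum c K.+2 = (bsum c K.+1) + (bcoef c K.+1 *: (id ^+ K.+1 : R -> R)).
  by apply/funext => x; rewrite /bsum big_ord_recr /= fctE /= exprfctE.
apply: (is_derive_eq (is_deriveD IH
  (is_deriveZ (bcoef c K.+1) (is_deriveX K.+1 (is_derive_id u 1))))).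
rewrite (mul_bcoefS c K.+1).
rewrite /= !fctE /GRing.scale/= exprS -[K.+1%:R]natr1.
by field.
Qed.

Lemma bsum0 c K : bsum c K.+1 0 = 1.
Proof.
rewrite /bsum big_ord_recl bcoef0 expr0 mulr1 big1 ?addr0// => i _.
by rewrite expr0n mulr0.
Qed.

(* [m] comes from the mean value theorem applied to [(1 - u) `^ c * bsum c K.+1 u], whose
   derivative is [- (1 - u) `^ (c - 1) * u ^+ K * (K.+1%:R * bcoef c K.+1)]. *)
Lemma bsum_remainder c K z : 0 <= z < 1 ->
  exists2 m, 0 <= m & (1 - z) `^ (- c) - bsum c K.+1 z = m * bcoef c K.+1.
Proof.
(* The mean value theorem needs a nondegenerate interval, so [z = 0], where the remainder is zero,
   is treated apart. *)
move=> /andP[]; rewrite le_eqVlt => /predU1P[<- _|z0 z1].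
  by exists 0 => //; rewrite bsum0 subr0 powR1 subrr mul0r.
pose G u := (1 - u) `^ c * bsum c K.+1 u.
pose dG u := - ((1 - u) `^ (c - 1) * u ^+ K * (K.+1%:R * bcoef c K.+1)).
have dGE u : u < 1 -> is_derive u 1 G (dG u).
  move=> u1; have u0 : 0 < 1 - u by lra.
  have dp : is_derive u 1 (fun v => (1 - v) `^ c) (- (c * (1 - u) `^ (c - 1))).
    have d1 : is_derive u 1 (fun v : R => 1 - v) (- 1).
      by apply: is_derive_eq; rewrite add0r mul1r.
    have dc := @is_derive1_comp _ (fun v => v `^ c) (fun v : R => 1 - v) u _ _
      (is_derive1_powR c u0) d1.
    by apply: is_derive_eq; rewrite /GRing.scale/= mulrN1.
  have -> : dG u = (1 - u) `^ c *: ((c * bsum c K.+1 u -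
       K.+1%:R * bcoef c K.+1 * u ^+ K) / (1 - u))
       + bsum c K.+1 u *: - (c * (1 - u) `^ (c - 1)).
    (* Splitting off one factor [1 - u] clears the denominator, and the two terms in
       [c * bsum c K.+1 u] cancel. *)
    have -> : (1 - u) `^ c = (1 - u) * (1 - u) `^ (c - 1).
      rewrite -{2}(powRr1 (ltW u0)) -powRD; last by rewrite (gt_eqF u0) implybT.
      by rewrite (addrC 1 (c - 1)) subrK.
    by rewrite /dG /GRing.scale/=; field; rewrite gt_eqF.
  exact: is_deriveM dp (is_derive_bsum c K u u1).
have [||xi] := @MVT _ G dG 0 z z0.
- by move=> u; rewrite in_itv/= => /andP[_ uz]; apply: dGE; lra.
- apply: derivable_within_continuous => u; rewrite in_itv/= => /andP[_ uz].
  by have [] := dGE u (le_lt_trans uz z1).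
rewrite in_itv/= => /andP[xi0 xiz]; rewrite subr0 {1 2}/G bsum0 subr0 powR1 mulr1 => E.
have zc : 0 < (1 - z) `^ c by rewrite powR_gt0//; lra.
(* This is [- dG xi * z / (1 - z) ^ c] with the factor [bcoef c K.+1] removed; all that is left is
   nonnegative. *)
exists ((1 - z) `^ (- c) * ((1 - xi) `^ (c - 1) * xi ^+ K * K.+1%:R * z)).
  by rewrite !mulr_ge0 ?powR_ge0 ?exprn_ge0// ltW.
have p0 := lt0r_neq0 zc.
have GE : (1 - z) `^ c * bsum c K.+1 z = 1 + dG xi * z by rewrite -E; ring.
rewrite powRN; apply: (mulfI p0).
rewrite mulrBr divff// GE /dG; by field.
Qed.

End BinomialSeries.

Arguments bcoef {R} c k.
Arguments bsum {R} c K z.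

(* [g] has the constant sign of [r], so its L^1 norm is the absolute value of its integral. *)
Lemma le_normr_RintegralM (d : measure_display) (T : measurableType d)
    (R : realType) (mu : {measure set T -> \bar R}) (D : set T)
    (g h : T -> R) (r M : R) :
  measurable D -> mu.-integrable D (EFin \o g) ->
  (forall x, D x -> exists2 m, 0 <= m & g x = m * r) ->
  measurable_fun D h -> (forall x, D x -> `|h x| <= M) ->
  `|\int[mu]_(x in D) (g x * h x)| <= M * `|\int[mu]_(x in D) g x|.
Proof.
move=> mD ig gr mh hM.
have [D0|/set0P[x0 Dx0]] := eqVneq D set0.
  by rewrite D0 !Rintegral_set0 normr0 mulr0.
have M0 : 0 <= M by apply: le_trans (hM _ Dx0).
have bh : [bounded h x | x in D].
  by exists M; split => [|N /ltW MN x Dx]; [exact: num_real|exact: le_trans (hM _ Dx) MN].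
have igh : mu.-integrable D (EFin \o (fun x => g x * h x)).
  by have := integrableMl mD ig mh bh; apply: eq_integrable.
have gE x : D x -> `|g x| = Num.sg r * g x.
  by move=> /gr[m m0 ->]; rewrite normrM ger0_norm// [`|r|]normrEsg mulrCA.
apply: (le_trans (le_normr_Rintegral mD igh)).
apply: (@le_trans _ _ (\int[mu]_(x in D) (M * (Num.sg r * g x)))).
  apply: le_Rintegral => //.
  - have := integrable_norm igh; exact: eq_integrable.
  - have := integrableZl mD M (integrableZl mD (Num.sg r) ig).
    by apply: eq_integrable.
  - by move=> x Dx; rewrite normrM mulrC -gE// ler_wpM2r// hM.
rewrite RintegralZl//; last first.
  by have := integrableZl mD (Num.sg r) ig; apply: eq_integrable.
rewrite RintegralZl// ler_wpM2l//.
apply: (le_trans (ler_norm _)); rewrite normrM normr_sg.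
by case: eqP => _; rewrite ?mul0r ?mul1r.
Qed.

(** * Improper integrals of nonnegative functions at a right endpoint *)

Section Improper.
Variable R : realType.
Local Notation mu := (@lebesgue_measure R).

(** [f] may blow up at [b]. The fundamental theorem applies on each [[a, u n]] with [u n] increasing
    to [b], and monotone convergence passes to the limit. As [f] is nonnegative, finiteness of the
    limit is integrability. *)
Lemma integral_itvco_FTC2 (f F : R -> R) (a b l : R) : a < b ->
  (forall x, a <= x < b -> 0 <= f x) ->
  (forall x, a <= x < b -> {for x, continuous f}) ->
  (forall x, a <= x < b -> is_derive x 1 F (f x)) ->
  F x @[x --> b^'-] --> l ->
  mu.-integrable `[a, b[ (EFin \o f) /\ \int[mu]_(x in `[a, b[) f x = l - F a.
Proof.
move=> ab f0 cf dF Fl.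
(* The shift to [n.+2] makes [a < u n] strict already at [n = 0]. *)
pose u n := b - (b - a) / n.+2%:R.
have uE n : a < u n < b.
  rewrite /u; have n0 : 0 < n.+2%:R :> R by rewrite ltr0n.
  have : (b - a) / n.+2%:R < b - a.
    by rewrite ltr_pdivrMr// ltr_pMr ?subr_gt0// ltr1n.
  have : 0 < (b - a) / n.+2%:R by rewrite divr_gt0// subr_gt0.
  by move: (_ / _) => e h1 h2; apply/andP; split; lra.
have nu : {homo u : n m / (n <= m)%N >-> n <= m}.
  move=> n m nm; rewrite lerB// ler_wpM2l ?subr_ge0 ?(ltW ab)//.
  by rewrite lef_pV2 ?posrE ?ltr0n// ler_nat !ltnS.
have cu : u n @[n --> \oo] --> b.
  have : b - (b - a) * harmonic n.+1 @[n --> \oo] --> b - (b - a) * 0.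
    apply: cvgB; first exact: cvg_cst.
    apply: cvgMl_tmp; have := @cvg_harmonic R; rewrite -(cvg_shiftS (@harmonic R : nat -> R)); exact.
  by rewrite mulr0 subr0.
have cun : u n @[n --> \oo] --> b^'-.
  move=> P /= bP; have : \forall n \near \oo, u n < b -> P (u n) by exact: (cu _ bP).
  by apply: filterS => n; apply; case/andP: (uE n).
pose E n : set R := `[a, u n]%classic.
have EU : \bigcup_n E n = `[a, b[%classic.
  apply/seteqP; split => x /=.
    move=> [n _]; rewrite /E/= !in_itv/= => /andP[-> xu].
    by apply: le_lt_trans xu _; case/andP: (uE n).
  rewrite in_itv/= => /andP[ax xb].
  have : \forall n \near \oo, x < u n by exact: (cvgr_gt b cu).
  by move=> [n _ /(_ _ (leqnn n)) xun]; exists n => //; rewrite /E/= in_itv/= ax ltW.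
have cfE n : {within E n, continuous f}.
  apply: continuous_in_subspaceT => x /set_mem; rewrite /E/= in_itv/= => /andP[ax xu].
  by apply: cf; rewrite ax (le_lt_trans xu)//; case/andP: (uE n).
have IE n : (\int[mu]_(x in E n) (f x)%:E = (F (u n) - F a)%:E)%E.
  have /andP[au ub] := uE n.
  rewrite EFinB; apply: continuous_FTC2 => //.
  - exact: cfE.
  - have cF x : a <= x < b -> {for x, continuous F}.
      by move=> /dF [dx _]; apply/differentiable_continuous/derivable1_diffP.
    split.
    + by move=> x; rewrite in_itv/= => /andP[ax xu]; have [] : is_derive x 1 F (f x) by apply: dF; lra.
    + by apply: cvg_at_right_filter; apply: cF; lra.
    + by apply: cvg_at_left_filter; apply: cF; lra.
  - move=> x; rewrite in_itv/= => /andP[ax xu].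
    by rewrite derive1E; apply: derive_val; apply: dF; lra.
have mE n : measurable (E n) by exact: measurable_itv.
have mfE n : measurable_fun (E n) f.
  by apply: subspace_continuous_measurable_fun; [exact: mE|exact: cfE].
have fE n x : E n x -> 0 <= f x.
  rewrite /E/= in_itv/= => /andP[ax xu]; apply: f0.
  by case/andP: (uE n) => _ ub; lra.
have I : (\int[mu]_(x in `[a, b[) (f x)%:E = (l - F a)%:E)%E.
  have := @ge0_nondecreasing_set_cvg_integral _ (measurableTypeR R) _ E (EFin \o f) mu.
  rewrite EU => /(_ _ _ _ _)/cvg_lim <- //.
  - apply/cvg_lim => //; under eq_cvg do rewrite /= IE.
    apply: cvg_EFin; first exact: nearW.
    by apply: cvgB; [exact: cvg_comp cun Fl|exact: cvg_cst].
  - by move=> n m nm; rewrite subsetEset; apply: subset_itvl; rewrite bnd_simp nu.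
  - by move=> n; apply/measurable_EFinP; exact: mfE.
have mf : measurable_fun `[a, b[ f.
  by rewrite -EU; apply/measurable_fun_bigcup.
split; last by rewrite /Rintegral I.
apply/integrableP; split; first exact/measurable_EFinP.
rewrite [ltLHS](_ : _ = (l - F a)%:E) ?ltry// -I; apply: eq_integral => x.
by rewrite inE/= in_itv/= => /f0 fx; rewrite ger0_norm.
Qed.

End Improper.

(** The left side is the integral over [[0, 1]] of the partial sum for [(1 - s) ^ (al - 1)]. It
    telescopes, since [bcoef (1 - al) k / k.+1] is the difference of consecutive coefficients
    divided by [al]. *)
Lemma sum_bcoef_div (R : realType) (al : R) (K : nat) : al != 0 ->
  \sum_(k < K) bcoef (1 - al) k / k.+1%:R = (1 - bcoef (1 - al) K) / al.
Proof.
move=> al0; elim: K => [|K IH].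
  by rewrite big_ord0 bcoef0 subrr mul0r.
rewrite big_ord_recr/= IH bcoefS -natr1.
by field; rewrite al0 natr1 pnatr_eq0.
Qed.

Lemma Rintegral_sumZ (d : measure_display) (T : measurableType d)
    (R : realType) (mu : {measure set T -> \bar R}) (D : set T)
    (c : nat -> R) (f : nat -> T -> R) (K : nat) :
  measurable D -> (forall k, mu.-integrable D (EFin \o f k)) ->
  mu.-integrable D (EFin \o (fun x => \sum_(k < K) c k * f k x)) /\
  \int[mu]_(x in D) (\sum_(k < K) c k * f k x) =
  \sum_(k < K) c k * \int[mu]_(x in D) f k x.
Proof.
move=> mD fi; have cfi k : mu.-integrable D (EFin \o (fun x => c k * f k x)).
  by have := integrableZl mD (c k) (fi k); apply: eq_integrable.
elim: K => [|K [IHi IHE]].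
  split.
    rewrite (_ : _ \o _ = cst 0%E); first exact: integrable0.
    by apply/funext => x /=; rewrite big_ord0.
  under eq_Rintegral do rewrite big_ord0.
  by rewrite big_ord0 Rintegral_cst// mul0r.
split.
  have := integrableD mD IHi (cfi K); apply: eq_integrable => // x _ /=.
  by rewrite big_ord_recr.
under eq_Rintegral do rewrite big_ord_recr/=.
by rewrite RintegralD// IHE big_ord_recr RintegralZl.
Qed.

(** * Integrals of the logarithmic kernels and the termwise integrated binomial series *)

Section LogKernels.
Variables (R : realType) (a t : R).
Hypotheses (a0 : 0 < a) (at_ : a < t).
Local Notation mu := (@lebesgue_measure R).

(** The substitution variable [s]. Since [d tau / tau] is [ln (t / a) ds], the kernels below carry a
    factor [1 / tau]. *)
Definition lograt (tau : R) : R := ln (tau / a) / ln (t / a).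

Let t0 : 0 < t. Proof. exact: lt_trans a0 at_. Qed.

Lemma ln_div_gt0 : 0 < ln (t / a).
Proof. by rewrite ln_gt0// ltr_pdivlMr// mul1r. Qed.

Let L0 := ln_div_gt0.
Let Ln0 : ln (t / a) != 0. Proof. exact: lt0r_neq0. Qed.

Lemma lograt_itv (tau : R) : a <= tau < t -> 0 <= lograt tau < 1.
Proof.
move=> /andP[atau taut]; have tau0 : 0 < tau by exact: lt_le_trans a0 atau.
rewrite /lograt divr_ge0 ?(ltW L0)//; last by rewrite ln_ge0// ler_pdivlMr// mul1r.
rewrite ltr_pdivrMr// mul1r ltr_ln ?posrE ?divr_gt0//.
by rewrite ltr_pM2r// invr_gt0.
Qed.

Lemma lograt_left : lograt a = 0.
Proof. by rewrite /lograt divff ?lt0r_neq0// ln1 mul0r. Qed.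

Lemma lograt_right : lograt t = 1.
Proof. by rewrite /lograt divff. Qed.

Lemma is_derive_lograt (tau : R) : 0 < tau ->
  is_derive tau 1 lograt (tau^-1 / ln (t / a)).
Proof.
move=> tau0; have d1 : is_derive tau 1 (fun v : R => v / a) a^-1.
  have -> : (fun v : R => v / a) = a^-1 *: (id : R -> R).
    by apply/funext => v; exact: mulrC.
  apply: (is_derive_eq (is_deriveZ a^-1 (is_derive_id tau 1))).
  by rewrite /GRing.scale/= mulr1.
have d2 := @is_derive1_comp _ (@ln R) (fun v : R => v / a) tau _ _
  (is_derive1_ln (divr_gt0 tau0 a0)) d1.
have -> : lograt = (ln (t / a))^-1 *: (@ln R \o (fun v : R => v / a)).
  by apply/funext => v; exact: mulrC.
apply: (is_derive_eq (is_deriveZ (ln (t / a))^-1 d2)).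
by rewrite /GRing.scale/=; field; rewrite !lt0r_neq0.
Qed.

Lemma continuous_lograt (tau : R) : 0 < tau -> {for tau, continuous lograt}.
Proof.
move=> /is_derive_lograt[d _].
exact/differentiable_continuous/derivable1_diffP.
Qed.

Lemma continuous_lograt_expn k (tau : R) : 0 < tau ->
  {for tau, continuous (fun v => lograt v ^+ k)}.
Proof.
move=> /continuous_lograt ct.
exact: (cvg_comp _ _ ct (@exprn_continuous _ k _)).
Qed.

Lemma integral_lograt_expn k :
  mu.-integrable `[a, t[ (EFin \o (fun tau => lograt tau ^+ k / tau)) /\
  \int[mu]_(tau in `[a, t[) (lograt tau ^+ k / tau) = ln (t / a) / k.+1%:R.
Proof.
pose F tau := ln (t / a) / k.+1%:R * lograt tau ^+ k.+1.
have [] := @integral_itvco_FTC2 R (fun tau => lograt tau ^+ k / tau)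
   F a t (ln (t / a) / k.+1%:R) at_.
- move=> x /[dup] xat /andP[ax _]; rewrite divr_ge0 ?exprn_ge0//.
    by have /andP[] := lograt_itv _ xat.
  exact: le_trans (ltW a0) ax.
- move=> x /andP[ax _]; have x0 := lt_le_trans a0 ax.
  apply: cvgM; first exact: continuous_lograt_expn.
  by apply: cvgV; [exact: lt0r_neq0|exact: cvg_id].
- move=> x /andP[ax _]; have x0 := lt_le_trans a0 ax.
  have -> : F = (ln (t / a) / k.+1%:R) *: (lograt ^+ k.+1).
    by apply/funext => v; rewrite /F !fctE.
  apply: (is_derive_eq (is_deriveZ (ln (t / a) / k.+1%:R)
    (is_deriveX k.+1 (is_derive_lograt _ x0)))).
  rewrite /GRing.scale/=; field.
  by rewrite Ln0 nat1r pnatr_eq0 lt0r_neq0.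
- have -> : ln (t / a) / k.+1%:R = ln (t / a) / k.+1%:R * lograt t ^+ k.+1.
    by rewrite lograt_right expr1n mulr1.
  have ct : lograt x ^+ k.+1 @[x --> t] --> lograt t ^+ k.+1.
    exact: continuous_lograt_expn.
  exact: cvgMl_tmp (cvg_at_left_filter ct).
by move=> ? ->; rewrite /F lograt_left expr0n mulr0 subr0.
Qed.

(** For [al < 1] the kernel is singular at [t], hence the half-open interval. The antiderivative [F]
    still tends to 0 there because [al > 0]. *)
Lemma integral_lograt_powR (al : R) : 0 < al ->
  mu.-integrable `[a, t[ (EFin \o (fun tau => (1 - lograt tau) `^ (al - 1) / tau)) /\
  \int[mu]_(tau in `[a, t[) ((1 - lograt tau) `^ (al - 1) / tau) = ln (t / a) / al.
Proof.
move=> al0.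
pose F tau := - (ln (t / a) / al) * (1 - lograt tau) `^ al.
have dpow p x : a <= x < t ->
    is_derive x 1 (fun v => (1 - lograt v) `^ p)
      (p * (1 - lograt x) `^ (p - 1) * - (x^-1 / ln (t / a))).
  move=> /[dup] xat /andP[ax _]; have x0 := lt_le_trans a0 ax.
  have /andP[_ l1] := lograt_itv _ xat.
  have d1 := is_deriveB (is_derive_cst (1 : R) x (1 : R)) (is_derive_lograt _ x0).
  have l10 : 0 < 1 - lograt x by rewrite subr_gt0.
  have := @is_derive1_comp _ (fun v => v `^ p) (fun v => 1 - lograt v) x _ _
    (is_derive1_powR p l10) d1.
  by rewrite sub0r.
have [] := @integral_itvco_FTC2 R
  (fun tau => (1 - lograt tau) `^ (al - 1) / tau) F a t 0 at_.
- move=> x /andP[ax _]; rewrite divr_ge0 ?powR_ge0//.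
  exact: le_trans (ltW a0) ax.
- move=> x /[dup] xat /andP[ax _]; have x0 := lt_le_trans a0 ax.
  apply: cvgM.
    have [d _] := dpow (al - 1) x xat.
    have c : {for x, continuous (fun v : R => (1 - lograt v) `^ (al - 1))}.
      exact/differentiable_continuous/derivable1_diffP.
    exact: c.
  by apply: cvgV; [exact: lt0r_neq0|exact: cvg_id].
- move=> x /[dup] xat /andP[ax _]; have x0 := lt_le_trans a0 ax.
  apply: (is_derive_eq (is_deriveZ (- (ln (t / a) / al)) (dpow al x xat))).
  rewrite /GRing.scale/=; field.
  by rewrite Ln0 !lt0r_neq0.
(* The limit of the power at 0 is one-sided, so [1 - lograt x] must be shown to approach 0 through
   positive values. *)
- have lr : 1 - lograt x @[x --> t^'-] --> 0^'+.
    have c0 : 1 - lograt x @[x --> t^'-] --> 0.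
      have ct : lograt x @[x --> t] --> lograt t by exact: continuous_lograt.
      have := cvgB (cvg_cst (1 : R)) (cvg_at_left_filter ct).
      rewrite lograt_right subrr; exact.
    move=> P /= P0.
    have Q0 : nbhs (0 : R) (fun y => 0 < y -> P y) by exact: P0.
    have Q1 : \forall x \near t^'-, 0 < 1 - lograt x -> P (1 - lograt x).
      exact: (c0 _ Q0).
    have Q2 : \forall x \near t^'-, 0 < 1 - lograt x.
      near=> x; rewrite subr_gt0.
      have /andP[_ //] : 0 <= lograt x < 1.
      apply: lograt_itv; apply/andP; split.
        by apply: ltW; near: x; exact: nbhs_left_gt.
      by near: x; exact: nbhs_left_lt.
    have Q3 : \forall x \near t^'-, P (1 - lograt x).
      by apply: filterS2 Q1 Q2 => x; exact.
    exact: Q3.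
  have := cvgMl_tmp (a := - (ln (t / a) / al)) (cvg_comp _ _ lr (powR_cvg0 al0)).
  rewrite mulr0; exact.
by move=> ? ->; rewrite /F lograt_left subr0 powR1 mulr1 sub0r opprK.
Unshelve. all: by end_near. Qed.

Variables (h : R -> R) (M : R).
Hypotheses (mh : measurable_fun (`[a, t[ : set (measurableTypeR R)) h).
Hypotheses (hM : forall x, a <= x < t -> `|h x| <= M).

Lemma integrable_mul_bounded g : mu.-integrable `[a, t[ (EFin \o g) ->
  mu.-integrable `[a, t[ (EFin \o (fun x => g x * h x)).
Proof.
move=> ig; have mD : measurable (`[a, t[%classic : set (measurableTypeR R)) by exact: measurable_itv.
have bh : [bounded h x | x in `[a, t[%classic].
  exists M; split => [|N /ltW MN x]; first exact: num_real.
  by rewrite /= in_itv/= => /hM; move/le_trans; apply.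
by have := integrableMl mD ig mh bh; apply: eq_integrable.
Qed.

Lemma binomial_series_integral (al : R) : 0 < al ->
  \sum_(k < K) bcoef (1 - al) k *
    \int[mu]_(tau in `[a, t[) (lograt tau ^+ k / tau * h tau) @[K --> \oo] -->
  \int[mu]_(tau in `[a, t[) ((1 - lograt tau) `^ (al - 1) / tau * h tau).
Proof.
move=> al0; have mD : measurable (`[a, t[%classic : set (measurableTypeR R)) by exact: measurable_itv.
set J := \int[mu]_(tau in `[a, t[) _.
have [ig gE] := integral_lograt_powR al al0.
have ipE k := integral_lograt_expn k.
have ip k : mu.-integrable `[a, t[ (EFin \o (fun tau => lograt tau ^+ k / tau)).
  by case: (ipE k).
(* Sums of [K.+1] terms are the form in which [bsum_remainder] gives the sign. *)
rewrite -cvg_shiftS/=.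
have bound K : `|J - \sum_(k < K.+1) bcoef (1 - al) k *
    \int[mu]_(tau in `[a, t[) (lograt tau ^+ k / tau * h tau)|
    <= M * (ln (t / a) / al) * `|bcoef (1 - al) K.+1|.
  have [isum sumE] := @Rintegral_sumZ _ _ _ mu _ (bcoef (1 - al)) _ K.+1 mD ip.
  have [isumh sumhE] := @Rintegral_sumZ _ _ _ mu _ (bcoef (1 - al)) _ K.+1 mD
    (fun k => integrable_mul_bounded _ (ip k)).
  rewrite -sumhE -RintegralB//; last exact: integrable_mul_bounded.
  pose g tau := (1 - lograt tau) `^ (al - 1) / tau -
    \sum_(k < K.+1) bcoef (1 - al) k * (lograt tau ^+ k / tau).
  have igs : mu.-integrable `[a, t[ (EFin \o g).
    by have := integrableB mD ig isum; apply: eq_integrable.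
  (* The kernel contributes [ln (t / a) / al] and the partial sum [(1 - bcoef (1 - al) K.+1)] times
     as much; only the coefficient survives. *)
  have gE' : \int[mu]_(x in `[a, t[) g x = ln (t / a) / al * bcoef (1 - al) K.+1.
    rewrite RintegralB// gE sumE.
    under eq_bigr do rewrite (ipE _).2 mulrCA.
    rewrite -mulr_sumr sum_bcoef_div ?lt0r_neq0//; field.
    exact: lt0r_neq0.
  rewrite [X in `|X| <= _](_ : _ = \int[mu]_(x in `[a, t[) (g x * h x)); last first.
    apply: eq_Rintegral => x _; rewrite /g mulrBl mulr_suml; congr (_ - _).
    by apply: eq_bigr => k _; rewrite mulrA.
  rewrite -mulrA -[in leRHS](@ger0_norm _ (_ / al)) ?divr_ge0 ?(ltW L0) ?(ltW al0)// -normrM -gE'.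
  apply: (@le_normr_RintegralM _ _ _ mu _ g h (bcoef (1 - al) K.+1)) => //.
    move=> x; rewrite /= in_itv/= => /[dup] xat /andP[ax _].
    have x0 := lt_le_trans a0 ax.
    have [m m0 E] := bsum_remainder R (1 - al) K (lograt x) (lograt_itv _ xat).
    (* The factor [1 / x] is positive, so the sign of the remainder is kept. *)
    exists (m / x); first by rewrite divr_ge0// ltW.
    rewrite mulrAC -E opprB mulrBl /g /bsum mulr_suml.
    by congr (_ - _); apply: eq_bigr => k _; rewrite mulrA.
apply/cvgrPdist_le => e e0.
have cb : M * (ln (t / a) / al) * `|bcoef (1 - al) K.+1| @[K --> \oo] --> 0.
  rewrite -[X in _ --> X](mulr0 (M * (ln (t / a) / al))) -(normr0 R).
  apply: cvgMl_tmp; apply: cvg_norm.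
  by rewrite (cvg_shiftS (bcoef (1 - al))); exact: bcoef_cvg0.
near=> K; apply: (le_trans (bound K)); apply: (le_trans (ler_norm _)).
by near: K; apply: cvgr0_norm_le; [exact: cb|exact: e0].
Unshelve. all: by end_near. Qed.

End LogKernels.

(** * Evaluation of the coefficient series and assembly of the expansion *)

Lemma Ck_on_continuous (R : realType) m (a b : R) (x : R -> R) :
  Ck_on m a b x -> {within `[a, b], continuous x}.
Proof.
move=> [D [D0 [_ /(_ 0%N isT) cD]]].
apply: subspace_eq_continuous cD => t /set_mem; rewrite /= in_itv/= => tab.
exact: D0.
Qed.

(** The sum starts at coefficient index 1. Restoring the term 1 of index 0 gives, by [sum_bcoef],
    the coefficient [bcoef (1 - be) N], which tends to 0. *)
Lemma bcoef_series_cvg (R : realType) (be : R) (m : nat) : 0 < be ->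
  \sum_(m.+1 <= p < N) bcoef (- be) (p - m)%N @[N --> \oo] --> (-1 : R).
Proof.
move=> be0; rewrite -(cvg_shiftn m.+1)/=.
have E N : \sum_(m.+1 <= p < (N + m.+1)%N) bcoef (- be) (p - m)%N =
    bcoef (1 - be) N - 1.
  rewrite -{1}[m.+1]add0n big_addn addnK big_mkord.
  rewrite [1 - be]addrC -sum_bcoef big_ord_recl bcoef0 addrC addKr.
  by apply: eq_bigr => k _; rewrite addnS -addSn addnK.
under eq_cvg do rewrite E.
have := cvgB (bcoef_cvg0 R be be0) (cvg_cst (1 : R)).
rewrite sub0r; exact.
Qed.

Theorem theorem6p3 (R : realType) (alpha : R) (n : nat) (a b : R)
  (x : R -> R) (X : nat -> R -> R) :
  0 < alpha -> 0 < a -> a < b ->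
  Ck_on n.+1 a b x ->
  (* X k = x_{k,0} : x_{0,0} = x, x_{k+1,0}(t) = t * d/dt x_{k,0}(t) on [a,b] *)
  (forall t, a <= t <= b -> X 0%N t = x t) ->
  (forall k, (k < n)%N -> forall t, a <= t <= b ->
     exists d, deriv_within a b (X k) t d /\ X k.+1 t = t * d) ->
  forall t, a < t <= b ->
  let A_term i p := rising (- alpha - i%:R) (p + i - n)%N / ((p + i - n)`!)%:R in
  let A i := (Gamma (alpha + i%:R + 1))^-1 *
             (1 + limn (fun N => \sum_((n - i).+1 <= p < N) A_term i p)) in
  let B p := rising (1 - alpha) (p - n).-1 /
             (Gamma alpha * ((p - n)`!)%:R) in
  let V p := Rintegral (@lebesgue_measure R) `[a, t]
               (fun tau => (p - n)%:R * (ln (tau / a)) ^+ (p - n).-1 * x tau / tau) in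
  let B_term p := B p * (ln (t / a)) `^ (alpha + n%:R - p%:R) * V p in
  (forall i, (i <= n)%N ->
     cvgn (fun N => \sum_((n - i).+1 <= p < N) A_term i p)) /\
  cvgn (fun N => \sum_(n.+1 <= p < N) B_term p) /\
  hadamard_int alpha a x t =
    \sum_(0 <= i < n.+1) A i * (ln (t / a)) `^ (alpha + i%:R) * X i t
    + limn (fun N => \sum_(n.+1 <= p < N) B_term p).
Proof.
move=> al0 a0 ab Cx _ _ t /andP[at_ tb] A_term A B V B_term.
have cA i : (i <= n)%N ->
    \sum_((n - i).+1 <= p < N) A_term i p @[N --> \oo] --> (-1 : R).
  move=> lein.
  have ali0 : 0 < alpha + i%:R by rewrite ltr_wpDr.
  (* With [be = alpha + i], the term [A_term i p] is the coefficient of index [p - (n - i)], which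
     is [p + i - n] because [i <= n]. *)
  have := bcoef_series_cvg R _ (n - i) ali0.
  under eq_cvg => N.
    under eq_big_nat => p /andP[nip _].
      rewrite opprD (_ : (p - (n - i) = p + i - n)%N); last by rewrite subnBA.
      over.
    over.
  exact.
have A0 i : (i <= n)%N -> A i = 0.
  by move=> /cA /cvg_lim cAi; rewrite /A cAi// subrr mulr0.
have cx := Ck_on_continuous _ _ _ _ _ Cx.
have [M xM] : exists M, forall s, a <= s <= b -> `|x s| <= M.
  (* Boundedness here says that every number strictly above [M] is a bound, whence [M + 1]. *)
  have [M [_ /(_ (M + 1))]] := compact_bounded (continuous_compact cx (@segment_compact R a b)).
  rewrite ltrDl ltr01 => /(_ isT) H; exists (M + 1) => s sab.
  by apply: H; exists s => //; rewrite /= in_itv.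
have xM' s : a <= s < t -> `|x s| <= M.
  by move=> /andP[as_ st]; apply: xM; rewrite as_ (ltW (lt_le_trans st tb)).
have mx : measurable_fun (`[a, t[ : set (measurableTypeR R)) x.
  have mab : measurable (`[a, b]%classic : set (measurableTypeR R)) by exact: measurable_itv.
  have := subspace_continuous_measurable_fun mab cx.
  apply: measurable_funS => // s; rewrite /= !in_itv/= => /andP[-> st].
  exact: ltW (lt_le_trans st tb).
set L := ln (t / a); have L0 : 0 < L by exact: ln_div_gt0.
have t0 := lt_trans a0 at_.
pose J k := \int[@lebesgue_measure R]_(tau in `[a, t[) (lograt R a t tau ^+ k / tau * x tau).
pose I := \int[@lebesgue_measure R]_(tau in `[a, t[)
  ((1 - lograt R a t tau) `^ (alpha - 1) / tau * x tau).
have imul := integrable_mul_bounded R a t x M mx xM'.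
(* The statement integrates over [[a, t]], the kernel lemmas over [[a, t[]; the endpoint is a null
   set. *)
have itv_IE (c : R) g : integrable (@lebesgue_measure R) `[a, t[ (EFin \o g) ->
    \int[@lebesgue_measure R]_(tau in `[a, t]) (c * (g tau * x tau)) =
    c * \int[@lebesgue_measure R]_(tau in `[a, t[) (g tau * x tau).
  move=> ig; rewrite -RintegralZl//; last exact: imul.
  rewrite Rintegral_itv_bndo_bndc//.
  have mD : measurable (`[a, t[%classic : set (measurableTypeR R)) by exact: measurable_itv.
  by have := integrableZl mD c (imul _ ig); apply: eq_integrable.
(* With [p = k + n + 1] one has [p - n = k + 1], and [ln (tau / a) ^ k] is [L ^ k] times the power
   of [lograt]. *)
have VE k : V (k + n.+1)%N = k.+1%:R * L ^+ k * J k.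
  rewrite /J -itv_IE; last by have [] := integral_lograt_expn R a t a0 at_ k.
  apply: eq_Rintegral => s _.
  rewrite addnS -addSn addnK /= /lograt -/L expr_div_n.
  have : L ^+ k != 0 by rewrite expf_neq0 ?lt0r_neq0.
  move: (L ^+ k) (k.+1%:R) (ln (s / a) ^+ k) (s^-1) => l c u v l0.
  by field.
have HE : hadamard_int alpha a x t = (Gamma alpha)^-1 * (L `^ (alpha - 1) * I).
  rewrite /hadamard_int; congr (_ * _).
  rewrite /I -itv_IE; last by have [] := integral_lograt_powR R a t a0 at_ alpha al0.
  apply: eq_Rintegral => s; rewrite inE/= in_itv/= => /andP[as_ st].
  have s0 := lt_le_trans a0 as_.
  have -> : ln (t / s) = L * (1 - lograt R a t s).
    rewrite mulrBr mulr1 /lograt -/L [L * _]mulrC divfK ?lt0r_neq0// /L.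
    by rewrite !ln_div ?posrE//; ring.
  rewrite powRM ?(ltW L0)//; last first.
    rewrite subr_ge0 /lograt ler_pdivrMr// mul1r /L ler_ln ?posrE ?divr_gt0//.
    by rewrite ler_pM2r ?invr_gt0.
  by rewrite -!mulrA; congr (_ * (_ * _)); rewrite mulrC.
(* The factor [k + 1] of [V] reduces [(k + 1)!] to [k!], and its [L ^ k] turns the exponent
   [alpha - 1 - k] into [alpha - 1], so the prefactor is the same for all [k]. *)
have BE k : B_term (k + n.+1)%N =
    (Gamma alpha)^-1 * L `^ (alpha - 1) * (bcoef (1 - alpha) k * J k).
  rewrite /B_term VE /B -/L addnS -addSn addnK /= factS natrM /bcoef.
  have -> : L `^ (alpha + n%:R - (k.+1 + n)%:R) = L `^ (alpha - 1) / L ^+ k.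
    rewrite -powR_mulrn ?ltW// -powRB; last by rewrite (gt_eqF L0) implybT.
    by congr (_ `^ _); rewrite natrD -natr1; ring.
  rewrite !invfM.
  have : L ^+ k != 0 by rewrite expf_neq0 ?lt0r_neq0.
  have : k.+1%:R != 0 :> R by rewrite pnatr_eq0.
  move: (L ^+ k) (k.+1%:R) (L `^ _) (k`!%:R^-1) (Gamma alpha)^-1 => l c u v w c0 l0.
  by field; rewrite l0 c0.
have cB : \sum_(n.+1 <= p < N) B_term p @[N --> \oo] --> hadamard_int alpha a x t.
  rewrite HE mulrA -(cvg_shiftn n.+1)/=.
  have E N : \sum_(n.+1 <= p < (N + n.+1)%N) B_term p =
    (Gamma alpha)^-1 * L `^ (alpha - 1) * \sum_(k < N) bcoef (1 - alpha) k * J k.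
    rewrite -{1}[n.+1]add0n big_addn addnK big_mkord mulr_sumr.
    by apply: eq_bigr => k _; rewrite BE.
  under eq_cvg do rewrite E.
  apply: cvgMl_tmp; exact: (binomial_series_integral R a t a0 at_ x M mx xM').
split; first by move=> i /cA ?; apply/cvg_ex; exists (-1).
split; first by apply/cvg_ex; eexists; exact: cB.
rewrite big_nat big1 ?add0r; last first.
  by move=> i /andP[_ ?]; rewrite A0// !mul0r.
by apply/esym/cvg_lim.
Qed.
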